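(* Let $k$ be a field and let $A=kQ/I$ be a finite-dimensional monomial algebra over $k$. Then the quadruple $E_A=(E,P,L,d)$ associated with $A$ is a symmetric $f_s$-BC (symmetric fractional Brauer configuration of type S).
   Context: Paths are written from right to left; $s(p),t(p),l(p)$ denote the source, target and length of a path $p$. **Monomial algebras.** $Q$ is a finite quiver, $I$ is an ideal of $kQ$ generated by paths, contained in the ideal $kQ_{\ge 1}$ generated by the arrows and containing some power of $kQ_{\geq 1}$. A maximal path of $A=kQ/I$ is a path $p\notin I$ such that $\alpha p=0=p\alpha$ in $A$ for every arrow $\alpha\in Q_1$; $\mathcal M$ is the set of maximal paths. **The quadruple $E_A=(E,P,L,d)$.** $E$ consists of all $(e_i,p)$ with $p=(e_1\to e_2\to\cdots\to e_n)\in\mathcal M$ and $1\le i\le n$, where $e_i$ is the $i$-th vertex passed by $p$ (so $n=l(p)+1$); $(e_i,p)$ and $(e_j,p)$ with $i\ne j$ are distinct angles even if $e_i=e_j$ in $Q_0$. $P((e_i,p))=\{(e'_j,p')\in E\mid e'_j=e_i\text{ in }Q_0\}$. For $i<n$, $L((e_i,p))$ is the set of $(e'_j,p')$ such that the arrow of $p'$ starting at position $j$ equals the arrow of $p$ starting at position $i$; for the last position, $L((e_n,p))=\{(e_n,p)\}$. $d((e_i,p))=l(p)+1$. The action of $G=\langle g\rangle\cong(\mathbb Z,+)$ on $E$ is $g((e_i,p))=(e_{i+1},p)$ for $i<n$ and $g((e_n,p))=(e_1,p)$. **f-BC.** A fractional Brauer configuration (f-BC) is a quadruple $E=(E,P,L,d)$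 where $E$ is a $G$-set for $G=\langle g\rangle\cong(\mathbb Z,+)$, $P$ and $L$ are partitions of $E$ ($P(e)$, $L(e)$ denote the classes containing $e$), and $d:E\to\mathbb Z_{+}$ is a function to the positive integers, such that: (f1) $L(e)\subseteq P(e)$ and $P(e)$ is finite for each $e$; (f2) $L(e_1)=L(e_2)$ implies $P(g(e_1))=P(g(e_2))$; (f3) $d$ is constant on $\langle g\rangle$-orbits; (f4) $P(e_1)=P(e_2)$ iff $P(g^{d(e_1)}(e_1))=P(g^{d(e_2)}(e_2))$; (f5) $L(e_1)=L(e_2)$ iff $L(g^{d(e_1)}(e_1))=L(g^{d(e_2)}(e_2))$; (f6) for all $e,h\in E$ the formal sequence $L(g^{d(e)-1}(e))\cdots L(g(e))L(e)$ is not a proper subsequence (of consecutive terms) of $L(g^{d(h)-1}(h))\cdots L(g(h))L(h)$. $E$ is symmetric if $g^{d(e)}(e)=e$ for all $e\in E$. **Type S.** A standard sequence is $p=(g^{n-1}(e),\dots,g(e),e)$ with $e\in E$, $0\le n\le d(e)$ (for $n=0$ the trivial sequence $()_e$). Put ${}^\wedge p=(g^{d(e)-1}(e),\dots,g^n(e))$ if $0<n<d(e)$, ${}^\wedge p=()_{g^{d(e)}(e)}$ if $n=d(e)$, ${}^\wedge p=(g^{d(e)-1}(e),\dots,e)$ if $n=0$; and $p^\wedge=(g^{-1}(e),\dots,g^{n-d(e)}(e))$ if $0<n<d(e)$, $p^\wedge=()_e$ if $n=d(e)$, $p^\wedge=(g^{-1}(e),\dots,g^{-d(e)}(e))$ if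 $n=0$. Put $L(p)=L(g^{n-1}(e))\cdots L(e)$ (a formal sequence of classes of $L$) for $n>0$ and $L(()_e)=e_{P(e)}$ (a trivial symbol depending only on the class $P(e)$). Write $p\equiv q$ if $L(p)=L(q)$. For a set $\mathcal X$ of standard sequences (a single sequence being viewed as a one-element set), $[\mathcal X]$ is the set of standard sequences $q$ with $q\equiv p$ for some $p\in\mathcal X$, and ${}^\wedge\mathcal X=\{{}^\wedge p\mid p\in\mathcal X\}$, $\mathcal X^\wedge=\{p^\wedge\mid p\in\mathcal X\}$. An f-BC is of type S (an $f_s$-BC) if: (f7) $p\equiv q$ implies $[[{}^\wedge p]^\wedge]=[[{}^\wedge q]^\wedge]$ for all standard sequences $p,q$. *)

(* Defs.v *)
From HB Require Import structures.
From mathcomp Require Import all_boot all_order all_algebra.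
From mathcomp Require Import finmap monalg.
From mathcomp Require Import boolp classical_sets functions cardinality.

Set Implicit Arguments.
Unset Strict Implicit.
Unset Printing Implicit Defensive.

Import GRing.Theory.
Local Open Scope classical_set_scope.
Local Open Scope ring_scope.

(** * Fractional Brauer configurations *)

Section GSet.
Variable T : Type.

Definition is_zaction (a : int -> T -> T) : Prop :=
  (forall e, a 0 e = e) /\ (forall m n e, a (m + n) e = a m (a n e)).

(* The action generated by [g], where [g'] plays the role of its inverse. *)
Definition zaction_of (g g' : T -> T) (z : int) : T -> T :=
  match z with Posz n => iter n g | Negz n => iter n.+1 g' end.

(* A partition of [T] is represented by its class map [e |-> C e]. *)
Definition is_class_map (C : T -> set T) : Prop :=
  partition (range C) id setT /\ forall e, C e e.

End GSet.

Record quadruple := Quadruple {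
  angle :> Type;
  act : int -> angle -> angle;
  Pcl : angle -> set angle;
  Lcl : angle -> set angle;
  deg : angle -> nat }.

Section FBC.
Variable E : quadruple.
Implicit Types (e h : E) (n : nat).

(* [:: L(g^(n-1) e); ...; L(g e); L(e)] *)
Definition Lword e n : seq (set E) :=
  [seq Lcl (act i%:Z e) | i <- rev (iota 0 n)].

Definition proper_subsequence (T : Type) (s t : seq T) : Prop :=
  exists u v, t = u ++ s ++ v /\ u ++ v <> [::].

Record is_fBC : Prop := IsFBC {
  fbc_act : is_zaction (@act E);
  fbc_P : is_class_map (@Pcl E);
  fbc_L : is_class_map (@Lcl E);
  fbc_deg : forall e, (0 < deg e)%N;
  fbc_f1 : forall e, Lcl e `<=` Pcl e /\ finite_set (Pcl e);
  fbc_f2 : forall e1 e2, Lcl e1 = Lcl e2 -> Pcl (act 1 e1) = Pcl (act 1 e2);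
  fbc_f3 : forall e z, deg (act z e) = deg e;
  fbc_f4 : forall e1 e2, Pcl e1 = Pcl e2 <->
    Pcl (act (deg e1)%:Z e1) = Pcl (act (deg e2)%:Z e2);
  fbc_f5 : forall e1 e2, Lcl e1 = Lcl e2 <->
    Lcl (act (deg e1)%:Z e1) = Lcl (act (deg e2)%:Z e2);
  fbc_f6 : forall e h,
    ~ proper_subsequence (Lword e (deg e)) (Lword h (deg h)) }.

Definition is_symmetric : Prop := forall e, act (deg e)%:Z e = e.

(* The pair [(e, n)] stands for the sequence (g^(n-1) e, ..., g e, e), and for
   the trivial sequence ()_e when [n = 0]. *)
Definition standard (p : E * nat) : Prop := (p.2 <= deg p.1)%N.

(* The three cases in the definition of ^p are the cases 0 < n < d(e),
   n = d(e) and n = 0 of a single formula, and likewise for p^. *)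
Definition lhat (p : E * nat) : E * nat :=
  (act p.2%:Z p.1, (deg p.1 - p.2)%N).
Definition rhat (p : E * nat) : E * nat :=
  (act (p.2%:Z - (deg p.1)%:Z) p.1, (deg p.1 - p.2)%N).

(* [inl (P e)] is the trivial symbol e_{P(e)}. *)
Definition Lseq (p : E * nat) : set E + seq (set E) :=
  if p.2 is 0%N then inl (Pcl p.1) else inr (Lword p.1 p.2).

Definition sequiv (p q : E * nat) : Prop := Lseq p = Lseq q.

Definition sclosure (X : set (E * nat)) : set (E * nat) :=
  [set q | standard q /\ exists2 p, X p & sequiv q p].

Definition is_fsBC : Prop :=
  is_fBC /\
  forall p q, standard p -> standard q -> sequiv p q ->
    sclosure (rhat @` sclosure [set lhat p]) =
    sclosure (rhat @` sclosure [set lhat q]).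

End FBC.

(** * Quivers and path algebras *)

Record quiver := Quiver {
  Qvert : finType;
  Qarr : finType;
  qsrc : Qarr -> Qvert;
  qtgt : Qarr -> Qvert }.

Section Paths.
Variable Q : quiver.

Fixpoint walk (x : Qvert Q) (s : seq (Qarr Q)) : bool :=
  if s is a :: s' then (qsrc a == x) && walk (qtgt a) s' else true.

(* A path is its source together with its arrows, listed in the order in which
   they are traversed, i.e. from right to left in the usual notation. *)
Record qpath := QPath {
  path_data : Qvert Q * seq (Qarr Q);
  _ : walk path_data.1 path_data.2 }.

HB.instance Definition _ := [isSub for path_data].
(* The structural instances [... by <:] make unification in the path algebra
   below extremely slow; these opaque ones do not. *)
HB.instance Definition _ := gen_eqMixin qpath.
HB.instance Definition _ := gen_choiceMixin qpath.

Definition psrc (p : qpath) : Qvert Q := (path_data p).1.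
Definition parrows (p : qpath) : seq (Qarr Q) := (path_data p).2.
Definition plen (p : qpath) : nat := size (parrows p).
Definition pverts (p : qpath) : seq (Qvert Q) :=
  psrc p :: map (@qtgt Q) (parrows p).
Definition ptgt (p : qpath) : Qvert Q := last (psrc p) (pverts p).

Definition pid (x : Qvert Q) : qpath := @QPath (x, [::]) isT.

Lemma parrow_subproof (a : Qarr Q) : walk (qsrc a) [:: a].
Proof. by rewrite /= eqxx. Qed.
Definition parrow (a : Qarr Q) : qpath :=
  @QPath (qsrc a, [:: a]) (parrow_subproof a).

Lemma walk_cat x s1 s2 :
  walk x (s1 ++ s2) = walk x s1 && walk (last x (map (@qtgt Q) s1)) s2.
Proof. by elim: s1 x => //= a s1 IH x; rewrite IH andbA. Qed.

(* The composite [q p], i.e. first [p], then [q]. *)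
Definition path_comp (q p : qpath) : option qpath :=
  if psrc q == ptgt p then insub (psrc p, parrows p ++ parrows q) else None.

Lemma path_compE q p : omap path_data (path_comp q p) =
  if psrc q == ptgt p then Some (psrc p, parrows p ++ parrows q) else None.
Proof.
rewrite /path_comp; case: eqP => // qp; case: insubP => [r _ <-//|].
rewrite /= walk_cat; case: p q qp => -[x s] /= ws [[y t] /= wt] /= yE.
rewrite ws /=; move: yE; rewrite /psrc /ptgt /= /psrc /parrows /= => <-.
by rewrite wt.
Qed.

Lemma omap_data_inj : injective (omap path_data).
Proof. by move=> [p|] [q|] //= [] /val_inj ->. Qed.

Lemma ptgt_cat r q p :
  path_comp q p = Some r -> ptgt r = ptgt q /\ psrc r = psrc p.
Proof.
move=> /(congr1 (omap path_data)); rewrite path_compE; case: eqP => //= qp [].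
rewrite /ptgt /pverts /psrc /parrows => <- /=; split => //.
move: qp; rewrite /ptgt /pverts /psrc /parrows /= => ->.
by rewrite map_cat last_cat.
Qed.

Lemma path_comp_id_l x p :
  path_comp (pid x) p = if x == ptgt p then Some p else None.
Proof.
apply: omap_data_inj; rewrite path_compE /=; case: ifP => //= _.
by rewrite cats0 -surjective_pairing.
Qed.

Lemma path_comp_id_r x p :
  path_comp p (pid x) = if psrc p == x then Some p else None.
Proof.
apply: omap_data_inj; rewrite path_compE /=; case: eqP => //= px.
by rewrite [path_data p in RHS]surjective_pairing -[_.1]/(psrc p) px.
Qed.

Lemma path_compA r q p :
  obind (path_comp r) (path_comp q p) = obind (path_comp^~ p) (path_comp r q).
Proof.
case qp: (path_comp q p) => [u|] /=; case rq: (path_comp r q) => [v|] //=;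
  apply: omap_data_inj; rewrite ?path_compE.
- have [-> ->] := ptgt_cat qp; have [_ ->] := ptgt_cat rq.
  have := congr1 (omap path_data) qp; have := congr1 (omap path_data) rq.
  rewrite !path_compE; case: eqP => // _ [] rqE; case: eqP => // _ [] qpE.
  by rewrite -[parrows u]/(path_data u).2 -[parrows v]/(path_data v).2
    -qpE -rqE /= catA.
- have [-> _] := ptgt_cat qp.
  by have := congr1 (omap path_data) rq; rewrite path_compE; case: eqP.
- have [_ ->] := ptgt_cat rq.
  by have := congr1 (omap path_data) qp; rewrite path_compE; case: eqP.
Qed.

End Paths.

Section PathAlgebra.
Variables (k : fieldType) (Q : quiver).

Definition pathalg : Type := {malg k[qpath Q]}.
HB.instance Definition _ := GRing.Lmodule.on pathalg.

Definition pelt (p : qpath Q) : pathalg := << p >>.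

(* The linear extension of [F] from paths to the path algebra. *)
Definition lin_ext (F : qpath Q -> pathalg) (x : pathalg) : pathalg :=
  \sum_(p <- msupp x) x@_p *: F p.

Definition pmul (x y : pathalg) : pathalg :=
  lin_ext (fun q => lin_ext (fun p => oapp pelt 0 (path_comp q p)) y) x.

Definition pone : pathalg := \sum_(x : Qvert Q) pelt (pid x).

Lemma lin_extw F x (d : {fset qpath Q}) : fsubset (msupp x) d ->
  lin_ext F x = \sum_(p <- d) x@_p *: F p.
Proof.
move=> sd; apply: (big_fset_incl _ sd) => p _ /mcoeff_outdom ->.
by rewrite scale0r.
Qed.

Lemma lin_ext_linear F a x y :
  lin_ext F (a *: x + y) = a *: lin_ext F x + lin_ext F y.
Proof.
pose d := fsetU (msupp x) (msupp y).
have sx : fsubset (msupp x) d by apply: fsubsetUl.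
have sy : fsubset (msupp y) d by apply: fsubsetUr.
rewrite (lin_extw F sx) (lin_extw F sy) (@lin_extw _ _ d).
  rewrite scaler_sumr -big_split; apply: eq_bigr => p _ /=.
  by rewrite mcoeffD mcoeffZ scalerDl scalerA.
apply: (fsubset_trans (msuppD_le _ _)); apply: fsetSU; exact: msuppZ_le.
Qed.

Lemma lin_extE F p : lin_ext F (pelt p) = F p.
Proof.
rewrite (@lin_extw _ _ [fset p]%fset) ?msuppU_le// big_seq_fset1.
by rewrite mcoeffUU scale1r.
Qed.

Lemma eq_lin_ext F G x : F =1 G -> lin_ext F x = lin_ext G x.
Proof. by move=> FG; apply: eq_bigr => p _; rewrite FG. Qed.

Lemma lin_ext_fun_linear F G a x :
  lin_ext (fun p => a *: F p + G p) x = a *: lin_ext F x + lin_ext G x.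
Proof.
rewrite /lin_ext scaler_sumr -big_split; apply: eq_bigr => p _ /=.
by rewrite scalerDr !scalerA mulrC.
Qed.

Lemma pathalg_ind (P : pathalg -> Prop) : P 0 ->
  (forall a p x, P x -> P (a *: pelt p + x)) -> forall x, P x.
Proof.
move=> P0 Pp x; rewrite [x]monalgE; elim/big_rec: _ => // p y _ Py.
suff -> : << x@_p *g p >> = x@_p *: pelt p by apply: Pp.
by apply/malgP => q; rewrite mcoeffZ !mcoeffU mulrnAr mulr1.
Qed.

Definition linear_fun (f : pathalg -> pathalg) : Prop :=
  forall a x y, f (a *: x + y) = a *: f x + f y.

Lemma linear_fun0 f : linear_fun f -> f 0 = 0.
Proof.
by move=> /(_ (-1) 0 0); rewrite scaler0 addr0 scaleN1r (addNr (f 0)).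
Qed.

Lemma linear_fun_eq f g : linear_fun f -> linear_fun g ->
  (forall p, f (pelt p) = g (pelt p)) -> forall x, f x = g x.
Proof.
move=> lf lg fg; apply: pathalg_ind => [|a p x IH].
  by rewrite (linear_fun0 lf) (linear_fun0 lg).
by rewrite lf lg IH fg.
Qed.

Lemma linear_fun_comp f g : linear_fun f -> linear_fun g ->
  linear_fun (fun x => f (g x)).
Proof. by move=> lf lg a x y; rewrite lg lf. Qed.

Lemma linear_fun_id : linear_fun id. Proof. by []. Qed.

Lemma linear_fun_sum f (F : Qvert Q -> pathalg) : linear_fun f ->
  f (\sum_x F x) = \sum_x f (F x).
Proof.
move=> lf; elim/big_ind2: _ => [|x u y v ux vy|//]; first exact: linear_fun0.
by have := lf 1 u v; rewrite -ux -vy !scale1r.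
Qed.

Lemma pmul_linl z : linear_fun (pmul^~ z).
Proof. by move=> a x y; apply: lin_ext_linear. Qed.

Lemma pmul_linr z : linear_fun (pmul z).
Proof.
move=> a x y; rewrite /pmul -lin_ext_fun_linear.
by apply: eq_lin_ext => q; apply: lin_ext_linear.
Qed.

Lemma pmul0x x : pmul 0 x = 0. Proof. exact: linear_fun0 (pmul_linl x). Qed.
Lemma pmulx0 x : pmul x 0 = 0. Proof. exact: linear_fun0 (pmul_linr x). Qed.

Lemma pmulDl : left_distributive pmul +%R.
Proof. by move=> x y z; have := pmul_linl z 1 x y; rewrite !scale1r. Qed.

Lemma pmulDr : right_distributive pmul +%R.
Proof. by move=> x y z; have := pmul_linr x 1 y z; rewrite !scale1r. Qed.

Lemma pmulZl a x y : pmul (a *: x) y = a *: pmul x y.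
Proof.
by have := pmul_linl y a x 0; rewrite /= pmul0x (addr0 (a *: x)) addr0.
Qed.

Lemma pmulZr a x y : pmul x (a *: y) = a *: pmul x y.
Proof.
by have := pmul_linr x a y 0; rewrite /= pmulx0 (addr0 (a *: y)) addr0.
Qed.

Lemma pmulE q p : pmul (pelt q) (pelt p) = oapp pelt 0 (path_comp q p).
Proof. by rewrite /pmul !lin_extE. Qed.

Lemma pmulA : associative pmul.
Proof.
move=> x y z.
move: x; apply: linear_fun_eq => [||r]; first exact: pmul_linl.
  exact: linear_fun_comp (pmul_linl _) (pmul_linl _).
move: y; apply: linear_fun_eq => [||q].
- exact: linear_fun_comp (pmul_linr _) (pmul_linl _).
- exact: linear_fun_comp (pmul_linl _) (pmul_linr _).
move: z; apply: linear_fun_eq => [||p]; last 1 first.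
- have := path_compA r q p; rewrite !pmulE.
  case: (path_comp q p) (path_comp r q) => [u|] [v|] /= => [uv|ru|vp|_].
  + by rewrite !pmulE uv.
  + by rewrite pmulE ru pmul0x.
  + by rewrite pmulE -vp pmulx0.
  + by rewrite pmulx0 pmul0x.
- exact: linear_fun_comp (pmul_linr _) (pmul_linr _).
- exact: pmul_linr.
Qed.

Lemma pone_sum (x : Qvert Q) (y : pathalg) :
  \sum_(z : Qvert Q) (if z == x then y else 0) = y.
Proof. by rewrite -big_mkcond big_pred1_eq. Qed.

Lemma pmul1x : left_id pone pmul.
Proof.
apply: linear_fun_eq (pmul_linr _) linear_fun_id _ => p; rewrite /pone.
rewrite (linear_fun_sum _ (pmul_linl (pelt p))).
rewrite -[RHS](pone_sum (ptgt p)); apply: eq_bigr => y _.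
by rewrite pmulE path_comp_id_l; case: ifP.
Qed.

Lemma pmulx1 : right_id pone pmul.
Proof.
apply: linear_fun_eq (pmul_linl _) linear_fun_id _ => p; rewrite /pone.
rewrite (linear_fun_sum _ (pmul_linr (pelt p))).
rewrite -[RHS](pone_sum (psrc p)); apply: eq_bigr => y _.
by rewrite pmulE path_comp_id_r eq_sym; case: ifP.
Qed.

HB.instance Definition _ :=
  GRing.Zmodule_isPzRing.Build pathalg pmulA pmul1x pmulx1 pmulDl pmulDr.

End PathAlgebra.

Arguments pelt k {Q} p.

(** * Two-sided ideals and monomial algebras *)

Section Ideals.
Variable R : pzRingType.
Implicit Types (J K S : set R).

Definition two_sided_ideal J : Prop :=
  [/\ J 0, forall x y, J x -> J y -> J (x + y) &
      forall a x, J x -> J (a * x) /\ J (x * a)].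

Definition ideal_gen S : set R := smallest two_sided_ideal S.

Definition ideal_mul J K : set R :=
  ideal_gen [set z | exists x y, [/\ J x, K y & z = x * y]].

Definition ideal_exp J m : set R := iter m (ideal_mul J) setT.

End Ideals.

Section MonomialAlgebra.
Variables (k : fieldType) (Q : quiver).
Implicit Types (I : set (pathalg k Q)) (p : qpath Q).

Definition arrow_elt (a : Qarr Q) : pathalg k Q := pelt k (parrow a).

(* kQ_{>= 1} *)
Definition arrow_ideal : set (pathalg k Q) := ideal_gen (range arrow_elt).

Definition is_monomial_ideal I : Prop :=
  [/\ exists S : set (qpath Q), I = ideal_gen (pelt k @` S),
      I `<=` arrow_ideal &
      exists m, ideal_exp arrow_ideal m `<=` I].

(* Vanishing of an element of kQ in the quotient A = kQ/I is membership
   in I. *)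
Definition maximal_path I : set (qpath Q) :=
  [set p | ~ I (pelt k p) /\
     forall a : Qarr Q, I (arrow_elt a * pelt k p) /\
                        I (pelt k p * arrow_elt a)].

Section Quadruple.
Variable I : set (pathalg k Q).

(* The angle (e_i, p) is encoded by [p] and the 0-based position [i - 1]. *)
Definition EA : Type := {p : maximal_path I & 'I_(plen (val p)).+1}.
Implicit Types x y : EA.

Definition EA_path x : qpath Q := val (tag x).
Definition EA_vert x : Qvert Q :=
  nth (psrc (EA_path x)) (pverts (EA_path x)) (tagged x).

(* The arrow of the path starting at the position of [x]; it is [None] exactly
   at the last position. *)
Definition EA_arr x : option (Qarr Q) := onth (parrows (EA_path x)) (tagged x).

(* [ordS] and [ord_pred] are the cyclic successor and predecessor. *)
Definition EA_next x : EA :=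
  Tagged (fun p : maximal_path I => 'I_(plen (val p)).+1) (ordS (tagged x)).
Definition EA_prev x : EA :=
  Tagged (fun p : maximal_path I => 'I_(plen (val p)).+1) (ord_pred (tagged x)).

Definition EA_P x : set EA := [set y | EA_vert y = EA_vert x].
Definition EA_L x : set EA :=
  if EA_arr x is Some a then [set y | EA_arr y = Some a] else [set x].

Definition E_A : quadruple :=
  Quadruple (zaction_of EA_next EA_prev) EA_P EA_L
    (fun x => (plen (EA_path x)).+1).

End Quadruple.

End MonomialAlgebra.

(* Main.v *)
Require Import Defs.
From mathcomp Require Import all_boot all_order all_algebra.
From mathcomp Require Import classical_sets boolp cardinality.

(** The last angle of a maximal path is alone in its class of [L], and the
    cyclic action brings it exactly once into each window of [d e] consecutive
    angles; call such an angle isolated.  An isolated angle is determined by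
    its class, so two words of classes that agree at an isolated letter come
    from the same angle.  With the symmetry of the configuration, this settles
    the two axioms that compare words.

    For (f6), the full word of [e] contains an isolated letter; if it occurs in
    the full word of [h], then [e] and [h] lie in one orbit, and the two words
    have the same length.

    For (f7), the sequences [p] and [^p] make up a full turn, so one of them
    goes through an isolated angle.  If it is [p], then [p] is the only sequence
    equivalent to it.  If it is [^p], then [[^p]] is [{^p}], and symmetry gives
    [(^p)^ = p], whence [[[^p]^] = [p]].  In both cases the set attached to [p]
    depends only on the class of [p].  [symmetric_isolated_fsBC] carries out this
    argument for symmetric quadruples in general.

    The algebra enters only in the finiteness of the classes of [P]: a power of
    the arrow ideal lies in [I], so the lengths of the maximal paths are bounded
    and there are finitely many angles ([finite_EA]). *)

Set Implicit Arguments.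
Unset Strict Implicit.
Unset Printing Implicit Defensive.

Import GRing.Theory.
Local Open Scope classical_set_scope.
Local Open Scope ring_scope.

(** * Class maps and actions of the integers *)

Lemma fiber_class_map (T U : Type) (f : T -> U) :
  is_class_map (fun x => [set y | f y = f x]).
Proof.
split=> //; split.
- by apply/seteqP; split=> // x _; exists [set y | f y = f x]; [exists x|].
- move=> _ _ [x _ <-] [y _ <-] [z [/= zx zy]].
  by rewrite -zx zy.
- by move=> _ [x _ <-]; exists x.
Qed.

Lemma fiber_eq (T U : Type) (f : T -> U) x y :
  [set z | f z = f x] = [set z | f z = f y] -> f x = f y.
Proof. by move=> /seteqP [/(_ x erefl)]. Qed.

Lemma zaction_ofP (T : Type) (g g' : T -> T) :
  cancel g g' -> cancel g' g -> is_zaction (zaction_of g g').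
Proof.
move=> gK g'K; split=> // m n e.
have succ z : zaction_of g g' (1 + z) e = g (zaction_of g g' z e).
  case: z => [j|[|j]]; first by rewrite -PoszD.
    by rewrite /= g'K.
  have -> : 1 + Negz j.+1 = Negz j by rewrite !NegzE [in LHS]intS opprD addNKr.
  by rewrite /= g'K.
have pred z : zaction_of g g' (-1 + z) e = g' (zaction_of g g' z e).
  by rewrite -[z in RHS](addKr (-1)) opprK succ gK.
elim/int_rect: m => [|m IH|m IH]; first by rewrite add0r.
  by rewrite intS -addrA succ IH -[1 + m%:Z]intS.
rewrite intS opprD -addrA pred IH -opprD -intS.
by case: m {IH}.
Qed.

(** * Isolated angles *)

Section Isolated.
Variable E : quadruple.
Implicit Types (e h : E) (p q : E * nat).

Definition isolated e := Lcl e = [set e].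

Definition meets_isolated p := exists2 i, (i < p.2)%N & isolated (act i%:Z p.1).

Lemma size_Lword e n : size (Lword e n) = n.
Proof. by rewrite size_map size_rev size_iota. Qed.

Lemma nth_Lword e n i : (i < n)%N ->
  nth set0 (Lword e n) (n - i.+1) = Lcl (act i%:Z e).
Proof.
move=> ltin.
have lt_rev : (n - i.+1 < n)%N by rewrite ltn_subrL (leq_ltn_trans _ ltin).
rewrite (nth_map 0%N) ?size_rev ?size_iota// nth_rev ?size_iota//.
by rewrite subnSK // subKn 1?ltnW // nth_iota.
Qed.

Hypothesis actP : is_zaction (@act E).
Hypothesis LP : is_class_map (@Lcl E).

Lemma actK z e : act (- z) (act z e) = e.
Proof. by rewrite -actP.2 addNr actP.1. Qed.

Lemma act_inj z : injective (act z : E -> E).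
Proof. by move=> e h /(congr1 (act (- z))); rewrite !actK. Qed.

Lemma isolated_inj e h : isolated e -> Lcl h = Lcl e -> h = e.
Proof. by move=> ie he; have := LP.2 h; rewrite he ie. Qed.

(** Equality of the words identifies the isolated angle met by [p] with the angle
    of [q] at the same place; the action being injective, the two sequences have
    the same starting angle. *)
Lemma meets_isolated_inj p q : meets_isolated p -> sequiv p q -> p = q.
Proof.
case: p q => [e n] [h m] [i /= ltin ie]; rewrite /sequiv /Lseq /=.
case: n ltin => // n ltin; case: m => // m [] Ew.
have nm : n.+1 = m.+1 by rewrite -(size_Lword e n.+1) Ew size_Lword.
rewrite -nm in Ew *; congr pair; apply: (@act_inj i%:Z); apply: esym.
by apply: isolated_inj ie _; rewrite -!(nth_Lword _ ltin) Ew.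
Qed.

Lemma eq_sclosure p q : sequiv p q -> sclosure [set p] = sclosure [set q].
Proof.
move=> pq; apply/seteqP; split=> r [sr [_ -> rp]]; split=> //.
- by exists q => //; apply: etrans rp pq.
- by exists p => //; apply: etrans rp (esym pq).
Qed.

Lemma sclosure_isolated p : standard p -> meets_isolated p ->
  sclosure [set p] = [set p].
Proof.
move=> sp ip; apply/seteqP; split=> [q [_ [_ -> qp]]|_ ->].
  by apply: esym; apply: meets_isolated_inj ip (esym qp).
by split=> //; exists p.
Qed.

Hypothesis degP : forall e z, deg (act z e) = deg e.
Hypothesis isolatedP : forall e, meets_isolated (e, deg e).

(** An occurrence of the full word of [e] in that of [h] carries an isolated
    letter along, which puts [e] and [h] into one orbit. *)
Lemma Lword_not_proper e h :
  ~ proper_subsequence (Lword e (deg e)) (Lword h (deg h)).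
Proof.
move=> [u [v [hE uv]]].
have [i /= lti ie] := isolatedP e.
have sE := congr1 size hE; rewrite !size_cat !size_Lword in sE.
(* [k] is the place of the isolated letter in the word of [h]; words list the
   last angle first, hence the reversed indices. *)
pose k := (size u + (deg e - i.+1))%N.
have ltk : (k < deg h)%N.
  rewrite sE ltn_add2l ltn_addr// ltn_subrL.
  exact: leq_ltn_trans lti.
have kE : (deg h - (deg h - k.+1).+1)%N = k by rewrite subnSK // subKn // ltnW.
have ltj : (deg h - k.+1 < deg h)%N.
  by rewrite ltn_subrL (leq_ltn_trans _ ltk).
have hj : Lcl (act (deg h - k.+1)%N%:Z h) = Lcl (act i%:Z e).
  rewrite -(nth_Lword _ ltj) kE hE nth_cat ltnNge leq_addr /= addKn.
  by rewrite nth_cat size_Lword ltn_subrL (leq_ltn_trans _ lti)//= nth_Lword.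
have dE : deg h = deg e.
  by rewrite -(degP h (deg h - k.+1)%N%:Z) (isolated_inj ie hj) degP.
apply: uv; apply: size0nil; rewrite size_cat.
by apply: (@addnI (deg e)); rewrite addnCA -sE addn0.
Qed.

Hypothesis symP : is_symmetric E.

Lemma lhatK p : standard p -> rhat (lhat p) = p.
Proof.
case: p => e n; rewrite /standard /rhat /lhat /= => len.
rewrite degP subKn// -actP.2 -subzn// addrAC subrK subrr.
by rewrite actP.1.
Qed.

Lemma standard_lhat p : standard (lhat p).
Proof. by rewrite /standard /= degP leq_subr. Qed.

(** [p] followed by [^p] is a full turn. *)
Lemma meets_isolated_lhat p : standard p -> ~ meets_isolated p ->
  meets_isolated (lhat p).
Proof.
case: p => e n sp np; have [i /= lti ie] := isolatedP e.
case: (ltnP i n) => [ltin|lein]; first by case: np; exists i.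
exists (i - n)%N; first by rewrite /= ltn_sub2r// (leq_ltn_trans lein).
by rewrite /= -actP.2 -PoszD subnK.
Qed.

Lemma sclosure_hats p : standard p -> ~ meets_isolated p ->
  sclosure (@rhat E @` sclosure [set lhat p]) = sclosure [set p].
Proof.
move=> sp np; rewrite sclosure_isolated; first by rewrite image_set1 lhatK.
- exact: standard_lhat.
- exact: meets_isolated_lhat.
Qed.

Lemma isolated_f7 p q : standard p -> standard q -> sequiv p q ->
  sclosure (@rhat E @` sclosure [set lhat p]) =
  sclosure (@rhat E @` sclosure [set lhat q]).
Proof.
move=> sp sq pq.
have [ip|np] := pselect (meets_isolated p).
  by rewrite (meets_isolated_inj ip pq).
have [iq|nq] := pselect (meets_isolated q).
  by rewrite (meets_isolated_inj iq (esym pq)).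
by rewrite !sclosure_hats// (eq_sclosure pq).
Qed.

(** By symmetry (f4) and (f5) are trivial, and isolated angles give the axioms
    on words (f6) and (f7), so the hypotheses are the elementary axioms. *)
Theorem symmetric_isolated_fsBC :
  is_class_map (@Pcl E) -> (forall e, (0 < deg e)%N) ->
  (forall e, Lcl e `<=` Pcl e /\ finite_set (Pcl e)) ->
  (forall e h, Lcl e = Lcl h -> Pcl (act 1 e) = Pcl (act 1 h)) ->
  is_fsBC E.
Proof.
move=> PP dP f1 f2; split; last exact: isolated_f7.
split=> //; try by move=> e h; rewrite !symP.
exact: Lword_not_proper.
Qed.

End Isolated.

(** * Finiteness of the set of angles *)

Section Quadruple.
Variables (k : fieldType) (Q : quiver).
Implicit Type p : qpath Q.

Lemma qpath_rcons p s a : parrows p = rcons s a ->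
  exists2 q, parrows q = s & path_comp (parrow a) q = Some p.
Proof.
case: p => -[x t] /= w; rewrite /parrows /= => tE.
have: walk x (rcons s a) by rewrite -tE.
rewrite -cats1 walk_cat /= andbT => /andP[ws /eqP sa].
exists (QPath (path_data := (x, s)) ws) => //.
apply: omap_data_inj; rewrite path_compE.
have -> : ptgt (QPath (path_data := (x, s)) ws) = qsrc a by [].
by rewrite eqxx /= tE -cats1.
Qed.

(** The powers of an ideal are built by multiplying on the left, so the induction
    splits off the arrow that is traversed last. *)
Lemma long_path_ideal_exp m p : (m <= plen p)%N ->
  ideal_exp (@arrow_ideal k Q) m (pelt k p).
Proof.
elim: m p => // m IH p; rewrite /plen.
case/lastP pE: (parrows p) => [//|s a]; rewrite size_rcons ltnS => lems.
have [q qE qp] := qpath_rcons pE.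
apply: sub_gen_smallest; exists (arrow_elt k a), (pelt k q); split.
- by apply: sub_gen_smallest; exists a.
- by apply: IH; rewrite /plen qE.
- by rewrite [RHS]pmulE qp.
Qed.

Variable I : set (pathalg k Q).

Lemma EA_inj (x y : EA I) :
  EA_path x = EA_path y -> tagged x = tagged y :> nat -> x = y.
Proof.
case: x y => [p i] [q j]; rewrite /EA_path /= => /val_inj pq.
by case: _ / pq j => j /= /ord_inj ->.
Qed.

Lemma finite_EA m : ideal_exp (@arrow_ideal k Q) m `<=` I ->
  forall A : set (EA I), finite_set A.
Proof.
move=> mI A.
have short (x : EA I) : (plen (EA_path x) < m)%N.
  case: x => -[p pM] i; rewrite ltnNge; apply/negP => /= lem.
  by have [np _] := set_mem pM; apply: np; apply/mI/long_path_ideal_exp.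
(* Bounded sequences of arrows form a finite type, in which the paths embed. *)
pose code (x : EA I) : Qvert Q * m.-bseq (Qarr Q) * 'I_m.+1 :=
  (psrc (EA_path x), insub_bseq m (parrows (EA_path x)), inord (tagged x)).
apply: (@sub_finite_set _ _ (code @^-1` setT)) => //.
apply: finite_preimage; last exact: finite_finset.
move=> x y _ _ [sE aE iE]; apply: EA_inj.
- apply: val_inj; rewrite [LHS]surjective_pairing [RHS]surjective_pairing.
  congr pair; first exact: sE.
  have arrE (z : EA I) :
      parrows (EA_path z) = insub_bseq m (parrows (EA_path z)).
    by rewrite /insub_bseq val_insubd ifT//; exact: ltnW (short z).
  by rewrite -/(parrows _) arrE aE -arrE.
- have tE (z : EA I) : (inord (tagged z) : 'I_m.+1) = tagged z :> nat.
    by rewrite inordK// ltnS (leq_trans (leq_ord _) (ltnW (short z))).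
  by rewrite -tE iE tE.
Qed.

(** * The quadruple of a monomial algebra *)

(** A label separating the classes of [L]: the outgoing arrow or, at the end of
    the path, the angle itself. *)
Definition EA_key (x : EA I) : Qarr Q + EA I :=
  if EA_arr x is Some a then inl a else inr x.

Lemma EA_LE x : EA_L x = [set y | EA_key y = EA_key x].
Proof.
rewrite /EA_L /EA_key; case xa: (EA_arr x) => [a|]; apply/seteqP; split=> y /=.
- by move=> ->.
- by case: (EA_arr y) => // b [->].
- by move=> ->; rewrite xa.
- by case: (EA_arr y) => // -[].
Qed.

Lemma walk_onth z x s i (a : Qarr Q) : walk x s -> onth s i = Some a ->
  nth z (x :: map (@qtgt Q) s) i = qsrc a.
Proof.
elim: s x i => [|b s IH] x [|i] //= /andP[/eqP xb ws]; first by case=> <-.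
exact: IH.
Qed.

Lemma EA_vert_src (x : EA I) a : EA_arr x = Some a -> EA_vert x = qsrc a.
Proof. exact: walk_onth (valP (EA_path x)). Qed.

Lemma EA_vert_next (x : EA I) a :
  EA_arr x = Some a -> EA_vert (EA_next x) = qtgt a.
Proof.
move=> xa; have lti : (tagged x < plen (EA_path x))%N.
  by rewrite -onthTE -/(EA_arr x) xa.
rewrite /EA_vert /= modn_small ?ltnS//= (nth_map a)//.
by congr (qtgt _); exact: onth_nth xa.
Qed.

Lemma EA_nextK : cancel (@EA_next k Q I) (@EA_prev k Q I).
Proof. by case=> p i; rewrite /EA_prev /EA_next /= ordSK. Qed.

Lemma EA_prevK : cancel (@EA_prev k Q I) (@EA_next k Q I).
Proof. by case=> p i; rewrite /EA_prev /EA_next /= ord_predK. Qed.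

Lemma EA_act_path (x : EA I) z : EA_path (@act (E_A I) z x) = EA_path x.
Proof. by case: z => n /=; elim: n => //= n ->. Qed.

Lemma EA_iter_next (x : EA I) n :
  tagged (iter n (@EA_next k Q I) x) =
    ((tagged x + n) %% (plen (EA_path x)).+1)%N :> nat.
Proof.
elim: n => [|n IH]; first by rewrite addn0 modn_small.
have pE : EA_path (iter n (@EA_next k Q I) x) = EA_path x.
  exact: (EA_act_path x n).
rewrite iterS -[LHS]/((tagged (iter n (@EA_next k Q I) x)).+1 %%
  (plen (EA_path (iter n (@EA_next k Q I) x))).+1)%N pE IH.
by rewrite -[in LHS]addn1 modnDml addn1 addnS.
Qed.

Lemma EA_symmetric : is_symmetric (E_A I).
Proof.
move=> x; apply: EA_inj; first exact: EA_act_path.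
by rewrite [LHS]EA_iter_next modnDr modn_small.
Qed.

(** Walking from [x] to the end of its path takes less than a full turn, and
    there the class of [L] is a singleton by definition. *)
Lemma EA_meets_isolated (x : E_A I) : meets_isolated (E := E_A I) (x, deg x).
Proof.
exists (plen (EA_path x) - tagged x)%N => /=; first by rewrite ltnS leq_subr.
have lex : (tagged x <= plen (EA_path x))%N by rewrite -ltnS; exact: ltn_ord.
set y := iter _ _ x.
have yE : EA_path y = EA_path x by exact: (EA_act_path x (Posz _)).
rewrite /isolated /= /EA_L /EA_arr onth_default// yE EA_iter_next.
by rewrite subnKC// modn_small.
Qed.

End Quadruple.

Theorem proposition3p1 (k : fieldType) (Q : quiver) (I : set (pathalg k Q))
  (hI : is_monomial_ideal I) :
  is_fsBC (E_A I) /\ is_symmetric (E_A I).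
Proof.
case: hI => _ _ [m mI]; split; last exact: EA_symmetric.
have LE : @Lcl (E_A I) = fun x => [set y | EA_key y = EA_key x].
  by apply/funext => x; exact: EA_LE.
have keyE (x y : E_A I) a : EA_arr x = Some a -> EA_key x = EA_key y ->
    EA_arr y = Some a.
  by rewrite /EA_key => ->; case: (EA_arr y) => // b [->].
apply: symmetric_isolated_fsBC.
- exact: zaction_ofP (@EA_nextK _ _ _) (@EA_prevK _ _ _).
- by rewrite LE; exact: fiber_class_map.
- by move=> x z /=; rewrite EA_act_path.
- exact: EA_meets_isolated.
- exact: EA_symmetric.
- exact: fiber_class_map.
- by [].
- move=> x; split; last exact: finite_EA mI _.
  move=> y /=; rewrite /EA_L; case xa: (EA_arr x) => [a|] /= => [ya|-> //].
  by rewrite /EA_P /= (EA_vert_src xa) (EA_vert_src ya).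
- move=> x y; rewrite LE => xyE.
  have xy : EA_key x = EA_key y by exact: fiber_eq xyE.
  case xa: (EA_arr x) => [a|].
    rewrite /= /EA_P (EA_vert_next xa).
    by rewrite (EA_vert_next (keyE _ _ _ xa xy)).
  case ya: (EA_arr y) => [a|]; first by rewrite (keyE _ _ _ ya (esym xy)) in xa.
  by move: xy; rewrite /EA_key xa ya => -[->].
Qed.
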